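(* Let $m,k,n$ be integers with $k\in\{1,\dots,m-2\}$ and $n\ge 6$. Consider approval elections with a set $N$ of $n$ agents and a set $A$ of $m$ alternatives, where the outcome must always be a committee of size $k$. Then there is no multi-winner approval-based voting rule that is both strongly group-strategyproof and unanimous.
   Context: An approval profile is a tuple $P=(P_i)_{i\in N}$ with $P_i\subseteq A$ an arbitrary subset (agent $i$'s approval ballot/preference; any size, including empty, is allowed). A committee of size $k$ is a set $S\subseteq A$ with $|S|=k$. A multi-winner approval-based voting rule $R$ is a (deterministic) function assigning to every approval profile $P$ a committee $R(P)$ of size $k$. For $Q,T\subseteq A$ the Hamming distance is $d(Q,T)=|Q\setminus T|+|T\setminus Q|$. For $S\subseteq N$, $P_S$ and $P_{-S}$ denote the restrictions of the profile $P$ to the agents in $S$ and to the agents not in $S$, respectively. $R$ is strongly group-strategyproof if for every profile $P$ and every coalition $S\subseteq N$ there is no profile $P'_S$ of ballots of the agents in $S$ such that $d(P_i,R(P_S,P_{-S}))\ge d(P_i,R(P'_S,P_{-S}))$ for every $i\in S$, with strict inequality for at least one $i\in S$. $R$ is unanimous if, for every $S\subseteq A$ with $|S|=k$, whenever $P_i=S$ for all $i\in N$ we have $R(P)=S$. *)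

(* Defs.v *)
From mathcomp Require Import all_boot.

Set Implicit Arguments.
Unset Strict Implicit.
Unset Printing Implicit Defensive.

Definition profile (N A : finType) := {ffun N -> {set A}}.

Definition committee (A : finType) (k : nat) := {S : {set A} | #|S| == k}.

(* Finite functions have extensional equality, so such an [R] is an arbitrary
   deterministic map from profiles to committees. *)
Definition voting_rule (N A : finType) (k : nat) := profile N A -> committee A k.

Definition hamming (A : finType) (Q T : {set A}) : nat :=
  #|Q :\: T| + #|T :\: Q|.

(* The profile (P'_S, P_{-S}).  [P'] is given on all of [N], but only its
   restriction to [S] matters. *)
Definition deviate (N A : finType) (S : {set N}) (P' P : profile N A) :
    profile N A :=
  [ffun i => if i \in S then P' i else P i].

Definition strongly_group_strategyproof (N A : finType) (k : nat)
    (R : voting_rule N A k) : Prop :=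
  forall (P : profile N A) (S : {set N}),
    ~ exists P' : profile N A,
        (forall i, i \in S ->
           hamming (P i) (val (R P))
             >= hamming (P i) (val (R (deviate S P' P)))) /\
        (exists2 i, i \in S &
           hamming (P i) (val (R P))
             > hamming (P i) (val (R (deviate S P' P)))).

Definition unanimous (N A : finType) (k : nat) (R : voting_rule N A k) : Prop :=
  forall (S : committee A k) (P : profile N A),
    (forall i, P i = val S) -> R P = S.

(* Main.v *)
Require Import Defs.
From mathcomp Require Import all_boot.
From mathcomp Require Import zify.

Set Implicit Arguments.
Unset Strict Implicit.
Unset Printing Implicit Defensive.

(** All committees have [k] members, so an agent with ballot [B] prefers [W]
    to [V] iff [#|B :&: W| > #|B :&: V|].  An agent with an empty ballot is
    indifferent and can join any coalition for free: with unanimity this gives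
    Pareto efficiency, and replacing ballots by empty ones never hurts an agent
    whose ballot is kept.  Take committees [C + a], [C + b], [C + c]
    with a common part [C] of size [k - 1].  If one agent voting [C + a] beats
    one agent voting [C + b], it beats any number of them; hence one of the two
    committees wins whoever votes for it, and this relation is a tournament.
    A tournament on [a, b, c] has a path, say [a > b > c].  Now let three agents
    vote [C + b], [C + a + c], [C + c].  The second one could
    enforce [C + a], so the outcome is inside [C + a + c], hence it is [C + c]
    by efficiency; but [C + b] would win if the second ballot were empty, so the
    third agent cannot get [C + c]. *)

Lemma hammingE (A : finType) (k : nat) (B W : {set A}) :
  #|W| = k -> hamming B W + (#|B :&: W|).*2 = #|B| + k.
Proof.
move=> hW; rewrite /hamming.
have := cardsID W B; have := cardsID B W.
rewrite (setIC W B); lia.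
Qed.

Lemma eq_of_leq_cardsI (A : finType) (k : nat) (B W : {set A}) :
  #|B| = k -> #|W| = k -> k <= #|B :&: W| -> B = W.
Proof.
move=> hB hW h.
have hs : B \subset W.
  by apply/setIidPl/eqP; rewrite eqEcard subsetIl hB.
by apply/eqP; rewrite eqEcard hs hB hW leqnn.
Qed.

(** * Consequences of strategyproofness and unanimity for a fixed rule *)

Section Rule.

Variables (N A : finType) (k : nat) (R : voting_rule N A k).
Hypotheses (gspR : strongly_group_strategyproof R) (unR : unanimous R).

Let out P : {set A} := val (R P).

Lemma card_out P : #|out P| = k.
Proof. exact/eqP/(valP (R P)). Qed.

Lemma no_improvement (P P' : profile N A) (S : {set N}) :
  (forall i, i \in S ->
     #|P i :&: out P| <= #|P i :&: out (deviate S P' P)|) ->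
  forall i, i \in S ->
     #|P i :&: out (deviate S P' P)| <= #|P i :&: out P|.
Proof.
move=> h i iS; rewrite leqNgt; apply/negP => hi.
apply: (gspR (P := P) (S := S)); exists P'; split=> [j jS|].
  have := h j jS.
  have := hammingE (P j) (card_out P).
  have := hammingE (P j) (card_out (deviate S P' P)); rewrite /out; lia.
exists i => //; move: hi.
have := hammingE (P i) (card_out P).
have := hammingE (P i) (card_out (deviate S P' P)); rewrite /out; lia.
Qed.

(** Agents with an empty ballot in [P] are indifferent, so they join [j] and cast whatever [P']
    prescribes; a gain for [j] would contradict [no_improvement]. *)
Lemma deviation_le (P P' : profile N A) (j : N) :
  (forall i, i != j -> P i = set0 \/ P' i = P i) ->
  #|P j :&: out P'| <= #|P j :&: out P|.
Proof.
move=> h; rewrite leqNgt; apply/negP => hlt.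
pose S := j |: [set i | P i == set0].
have dE : deviate S P' P = P'.
  apply/ffunP => i; rewrite ffunE !inE.
  case: (eqVneq i j) => //= ij.
  by case: eqP => // Pi; case: (h i ij).
have jS : j \in S by rewrite !inE eqxx.
move: (hlt); rewrite -{1}dE ltnNge => /negP; apply.
apply: no_improvement jS => i; rewrite dE !inE.
case/orP=> /eqP->; first exact: ltnW.
by rewrite !set0I.
Qed.

(** The grand coalition can enforce [W] by voting for it unanimously. *)
Lemma efficient (P : profile N A) (W : {set A}) :
  #|W| = k -> (forall i, #|P i :&: out P| <= #|P i :&: W|) ->
  forall i, #|P i :&: W| <= #|P i :&: out P|.
Proof.
move=> /eqP hW h i.
have dE : deviate setT [ffun=> W] P = [ffun=> W].
  by apply/ffunP => l; rewrite !ffunE inE.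
have oE : out [ffun=> W] = W.
  rewrite /out (unR (S := exist _ W hW)) //= => l; by rewrite ffunE.
have := no_improvement (P := P) (P' := [ffun=> W]) (S := setT).
by rewrite dE oE => /(_ (fun i _ => h i) i (in_setT i)).
Qed.

(** If no ballot were the outcome, each nonempty one would share at most k - 1 alternatives with it,
    hence no more than with [P i0]; efficiency then grants [P i0] in full. *)
Lemma out_is_ballot (P : profile N A) (i0 : N) :
  #|P i0| = k ->
  (forall i, P i = set0 \/ #|P i| = k /\ k.-1 <= #|P i :&: P i0|) ->
  exists i, P i = out P.
Proof.
move=> h0 h.
case: (boolP [exists i, P i == out P]) => [/existsP[i /eqP] |]; first by exists i.
rewrite negb_exists => /forallP nP; exists i0.
have lt_k i : #|P i| = k -> #|P i :&: out P| < k.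
  move=> hi; rewrite ltnNge; apply/negP => hk.
  by case/negP: (nP i); apply/eqP; exact: eq_of_leq_cardsI hi (card_out P) hk.
apply: eq_of_leq_cardsI (h0) (card_out P) _.
rewrite -{1}h0 -{1}(setIid (P i0)).
apply: (efficient h0) => i.
case: (h i) => [->|[hi hi0]]; first by rewrite !set0I.
apply: leq_trans hi0; have := lt_k i hi; lia.
Qed.

Definition vote2 i (X : {set A}) j Y : profile N A :=
  [ffun p => if p == i then X else if p == j then Y else set0].

Lemma vote2C i X j Y : i != j -> vote2 i X j Y = vote2 j Y i X.
Proof.
move=> ij; apply/ffunP => p; rewrite !ffunE.
by case: (eqVneq p i) => // ->; rewrite (negPf ij).
Qed.

(** Adjacency in the Johnson graph: distinct sets of size [k] share at most k - 1 elements, so the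
    last bound is an equality. *)
Definition adjacent (X Y : {set A}) :=
  [/\ #|X| = k, #|Y| = k, X != Y & k.-1 <= #|X :&: Y|].

Lemma adjacent_sym X Y : adjacent X Y -> adjacent Y X.
Proof. by case=> hX hY XY h; split; rewrite // 1?eq_sym // setIC. Qed.

Lemma adjacent_lt X Y : adjacent X Y -> #|X :&: Y| < k.
Proof.
case=> hX hY XY _; rewrite ltnNge; apply/negP => h.
by case/eqP: XY; exact: eq_of_leq_cardsI hX hY h.
Qed.

Lemma out_vote2 i X j Y : adjacent X Y -> i != j ->
  out (vote2 i X j Y) = X \/ out (vote2 i X j Y) = Y.
Proof.
move=> aXY ij; have [hX hY XY h] := aXY.
have [| l|p] := @out_is_ballot (vote2 i X j Y) i.
- by rewrite ffunE eqxx.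
- rewrite !ffunE eqxx; case: ifP => _.
    by right; rewrite setIid hX leq_pred.
  case: ifP => _; last by left.
  by right; rewrite setIC.
rewrite ffunE; case: ifP => _ Ep; first by left.
move: Ep; case: ifP => _ Ep; first by right.
(* An empty ballot could win only for k = 0, where [X] and [Y] would both be empty. *)
have := card_out (vote2 i X j Y); rewrite -Ep cards0 => k0.
by move: hX hY XY; rewrite -k0 => /eqP; rewrite cards_eq0 => /eqP-> /eqP;
   rewrite cards_eq0 => /eqP->; rewrite eqxx.
Qed.

(** The profile [Q], where all but [i] vote [Y], links the two duels: it elects [X], since otherwise
    [j] and the silent agents would move to it; hence [i] and the silent agents can enforce [X]
    against [l]. *)
Lemma beats_any i X j Y l : adjacent X Y -> i != j -> i != l ->
  out (vote2 i X j Y) = X -> out (vote2 i X l Y) = X.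
Proof.
move=> aXY ij il E; have [hX hY XY h] := aXY.
pose Q : profile N A := [ffun p => if p == i then X else Y].
have QX : out Q = X.
  have [| r|p] := @out_is_ballot Q i.
  - by rewrite ffunE eqxx.
  - right; rewrite !ffunE eqxx; case: ifP => _.
      by rewrite setIid hX leq_pred.
    by rewrite setIC.
  rewrite ffunE; case: ifP => // _ QY.
  have := @deviation_le (vote2 i X j Y) Q j.
  rewrite E -QY !ffunE eqxx eq_sym (negPf ij) setIid hY setIC.
  rewrite leqNgt (adjacent_lt aXY) => H.
  suff: false by [].
  apply: H => {}p pj; rewrite !ffunE (negPf pj).
  by case: (p == i); [right|left].
apply/esym/(eq_of_leq_cardsI hX (card_out _)).
have := @deviation_le (vote2 i X l Y) Q i.
rewrite QX ffunE eqxx setIid hX; apply=> p pi; rewrite !ffunE (negPf pi).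
by case: (p == l); [right|left].
Qed.

Definition dominates (X Y : {set A}) :=
  forall i j, i != j -> out (vote2 i X j Y) = X.

Lemma dominates_total X Y : 2 < #|N| -> adjacent X Y ->
  dominates X Y \/ dominates Y X.
Proof.
move=> hN aXY.
have aYX := adjacent_sym aXY.
have nXY : X <> Y by case: aXY => _ _ /eqP.
have beaten i j l : i != j -> l != j ->
    out (vote2 i X j Y) = Y -> out (vote2 l X j Y) = Y.
  move=> ij lj; rewrite !(vote2C X Y) //.
  by apply: beats_any => //; rewrite eq_sym.
have [/existsP[i /existsP[j /andP[ij /eqP E]]]|nX] :=
    boolP [exists i, exists j, (i != j) && (out (vote2 i X j Y) == X)];
  last first.
  right=> j i ji; have ij : i != j by rewrite eq_sym.
  rewrite vote2C //; case: (out_vote2 aXY ij) => // E.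
  by case/existsP: nX; exists i; apply/existsP; exists j; rewrite ij E eqxx.
left=> p q pq; case: (out_vote2 aXY pq) => // F.
(* Voting [X], agent [i] wins every duel, and so does [q] voting [Y]; if they are distinct, their
   own duel would have both outcomes. *)
have [iq|iq] := eqVneq i q; last first.
  by case: nXY; rewrite -(beats_any aXY ij iq E) (beaten p q i).
subst q.
(* If they are the same agent, let [p] with [X] face a third agent [r] with [Y]: the winner would
   also beat [i], who cannot lose with either ballot. *)
have [r ri rp] : exists2 r, r != i & r != p.
  have : 0 < #|~: [set i; p]|.
    rewrite cardsCs setCK cards2 eq_sym pq; lia.
  by case/card_gt0P=> r; rewrite !inE negb_or => /andP[]; exists r.
have ir : i != r by rewrite eq_sym.
have pr : p != r by rewrite eq_sym.
case: (out_vote2 aXY pr) => G.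
  by case: nXY; rewrite -F (beats_any aXY pr pq G).
by case: nXY; rewrite -(beaten p r i pr ir G) (beats_any aXY ij ir E).
Qed.

Lemma no_dominance_path X Y Z :
  2 < #|N| -> adjacent X Y -> adjacent Y Z -> adjacent X Z ->
  ~~ (Y \subset X :|: Z) -> dominates X Y -> ~ dominates Y Z.
Proof.
move=> /card_gt2P[p [q [r [_ [pq qr rp]]]]] aXY aYZ aXZ nY dXY dYZ.
have [qp rq pr] : [/\ q != p, r != q & p != r] by split; rewrite eq_sym.
have [hX hY nXY hXY] := aXY; have [_ hZ nYZ hYZ] := aYZ.
have [_ _ nXZ hXZ] := aXZ.
pose vote B : profile N A :=
  [ffun i => if i == p then Y else if i == q then B
             else if i == r then Z else set0].
have votep B : vote B p = Y by rewrite ffunE eqxx.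
have voteq B : vote B q = B by rewrite ffunE (negPf qp) eqxx.
have voter B : vote B r = Z by rewrite ffunE (negPf rp) (negPf rq) eqxx.
(* With the ballot of [q] emptied, [Y] wins; from there [q] could help [r] for free, so no [B]
   brings [r] all of [Z]. *)
have r_loses B : #|Z :&: out (vote B)| < k.
  have := @deviation_le (vote2 p Y r Z) (vote B) r.
  rewrite (dYZ p r) // ffunE (negPf rp) eqxx => H.
  apply: (leq_ltn_trans (H _)) => [i ir|]; last first.
    by rewrite setIC; apply: adjacent_lt.
  rewrite !ffunE (negPf ir); do 2?[case: ifP => _]; by [right | left].
have p_loses : #|Y :&: out (vote X)| < k.
  have := @deviation_le (vote2 q X p Y) (vote X) p.
  rewrite (dXY q p) // ffunE (negPf pq) eqxx => H.
  apply: (leq_ltn_trans (H _)) => [i ip|]; last first.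
    by rewrite setIC; apply: adjacent_lt.
  rewrite !ffunE (negPf ip); case: ifP => _; by [left | right].
have oX : out (vote X) = X.
  have [| i|i] := @out_is_ballot (vote X) q.
  - by rewrite voteq.
  - rewrite voteq ffunE; do 3?[case: ifP => _]; try by left.
    + by right; rewrite setIC.
    + by right; rewrite setIid hX leq_pred.
    + by right; rewrite setIC.
  rewrite ffunE; case: ifP => _ E.
    by move: p_loses; rewrite -E setIid hY ltnn.
  move: E; case: ifP => _ // E; move: E; case: ifP => _ E.
    by move: (r_loses X); rewrite -E setIid hZ ltnn.
  (* An empty ballot as outcome means k = 0, against the strict bound in [r_loses]. *)
  have := r_loses X; have := card_out (vote X).
  by rewrite -E cards0 => <-.
pose W := out (vote (X :|: Z)).
have sW : W \subset X :|: Z.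
  (* Reporting [X] would give [q] a committee of approved members only, so the ballot [X :|: Z] must
     do so too. *)
  have := @deviation_le (vote (X :|: Z)) (vote X) q.
  rewrite oX voteq (setIidPr (subsetUl X Z)) hX => H.
  apply/setIidPr/eqP; rewrite eqEcard subsetIr card_out H // => i iq.
  by right; rewrite !ffunE (negPf iq).
have pW : #|Y :&: W| < k.
  rewrite ltnNge; apply: contra nY => h.
  by rewrite (eq_of_leq_cardsI hY (card_out _) h).
have := r_loses (X :|: Z); rewrite ltnNge => /negP; apply.
(* Passing to [Z] costs [p] nothing, as [pW] leaves [p] at most k - 1 members, and it is optimal for
   [q] and [r]. *)
have /(_ _ r) := efficient (P := vote (X :|: Z)) hZ.
rewrite voter setIid hZ; apply=> i.
rewrite -/W ffunE; do 3?[case: ifP => _].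
- by apply: leq_trans hYZ; lia.
- by rewrite (setIidPr (subsetUr X Z)) hZ -(card_out (vote (X :|: Z)))
             subset_leq_card // subsetIr.
- by rewrite setIid subset_leq_card // subsetIl.
- by rewrite !set0I.
Qed.

End Rule.

(** * Three committees with a common part, and the contradiction *)

Lemma adjacent_setU1 (A : finType) (k : nat) (C : {set A}) x y :
  0 < k -> #|C| = k.-1 -> x \notin C -> y \notin C -> x != y ->
  adjacent k (x |: C) (y |: C).
Proof.
move=> k0 hC xC yC xy; split.
- by rewrite cardsU1 xC hC; lia.
- by rewrite cardsU1 yC hC; lia.
- apply/eqP => /setP/(_ x).
  by rewrite !inE eqxx (negPf xC) (negPf xy).
- by rewrite -hC subset_leq_card // subsetI !subsetUr.
Qed.

Theorem theorem3 (m k n : nat) (N A : finType)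
    (hN : #|N| = n) (hA : #|A| = m)
    (hk : 1 <= k <= m - 2) (hn : 6 <= n) :
  ~ exists R : voting_rule N A k,
      strongly_group_strategyproof R /\ unanimous R.
Proof.
case=> R [gspR unR].
have N3 : 2 < #|N| by lia.
have A3 : 2 < #|A| by lia.
have /card_gt2P[a [b [c [_ [ab bc ca]]]]] := A3.
(* Room for [C] outside [a], [b], [c] means k - 1 <= m - 3, which is the bound k <= m - 2. *)
have [C hC [aC bC cC]] :
    exists2 C : {set A}, #|C| = k.-1 & [/\ a \notin C, b \notin C & c \notin C].
  have /card_geqP[s [us ss sub]] : k.-1 <= #|~: [set a; b; c]|.
    have := cardsC [set a; b; c]; have [+ _] := leq_card_setU [set a; b] [set c].
    rewrite !cards1 cards2; lia.
  exists [set x in s]; first by rewrite cardsE (card_uniqP us).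
  by split; rewrite inE; apply/negP => /sub; rewrite !inE eqxx ?orbT.
have adj x y : x \notin C -> y \notin C -> x != y ->
    adjacent k (x |: C) (y |: C).
  by apply: adjacent_setU1 => //; case/andP: hk.
have tot x y : x \notin C -> y \notin C -> x != y ->
    dominates R (x |: C) (y |: C) \/ dominates R (y |: C) (x |: C).
  by move=> xC yC xy; apply: dominates_total => //; apply: adj.
have no_path x y z : x \notin C -> y \notin C -> z \notin C ->
    x != y -> y != z -> x != z ->
    dominates R (x |: C) (y |: C) -> ~ dominates R (y |: C) (z |: C).
  move=> xC yC zC xy yz xz.
  apply: (no_dominance_path gspR unR N3); try exact: adj.
  apply/subsetPn; exists y; first exact: setU11.
  by rewrite !inE !negb_or (negPf yC) eq_sym xy yz.
have [ba cb ac] : [/\ b != a, c != b & a != c] by split; rewrite eq_sym.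
(* Each of the eight orientations of the triangle contains a directed path through all three
   vertices. *)
case: (tot a b) => // dab; case: (tot b c) => // dbc; case: (tot a c) => // dac;
  solve [ by case: (no_path a b c) | by case: (no_path a c b)
        | by case: (no_path b a c) | by case: (no_path b c a)
        | by case: (no_path c a b) | by case: (no_path c b a) ].
Qed.
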